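(* Assume that there is no quasi-measurable cardinal smaller than $2^\omega$. Let $X$ be an uncountable Polish space and let $\mathbb{I}\subseteq P(X)$ be a $\sigma$-ideal with Borel base containing all singletons, and assume that $\mathbb{I}$ is c.c.c. Let $\mathcal{A}\subseteq\mathbb{I}$ be a family satisfying: (1) $\bigcup\mathcal{A}\notin\mathbb{I}$; (2) for every $x\in X$, $|\{A\in\mathcal{A}: x\in A\}|<\omega$. Then there exist pairwise disjoint subfamilies $\mathcal{A}_\xi\subseteq\mathcal{A}$, $\xi\in\omega_1$ (that is, $\mathcal{A}_\xi\cap\mathcal{A}_\zeta=\emptyset$ for $\xi\neq\zeta$), such that for each $\xi\in\omega_1$ the union $\bigcup\mathcal{A}_\xi$ is completely $\mathbb{I}$-nonmeasurable in $\bigcup\mathcal{A}$.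
   Context: $\mathrm{Borel}$ denotes the family of all Borel subsets of $X$. The $\sigma$-ideal $\mathbb{I}$ has a Borel base if for every $I\in\mathbb{I}$ there is $J\in\mathbb{I}\cap\mathrm{Borel}$ with $I\subseteq J$. The ideal $\mathbb{I}$ is c.c.c. if every family $\mathcal{F}\subseteq\mathrm{Borel}\setminus\mathbb{I}$ such that for all $A,A'\in\mathcal{F}$ either $A=A'$ or $A\cap A'\in\mathbb{I}$ is at most countable. A set $C$ is completely $\mathbb{I}$-nonmeasurable in $D$ (where $C,D\subseteq X$) if for every $B\in\mathrm{Borel}\setminus\mathbb{I}$: if $B\cap D\notin\mathbb{I}$, then $B\cap C\notin\mathbb{I}$ and $B\cap(D\setminus C)\notin\mathbb{I}$. An uncountable cardinal $\kappa$ is quasi-measurable if there exists a $\kappa$-additive (closed under unions of fewer than $\kappa$ members) proper ideal $\mathcal{J}$ of subsets of $\kappa$, containing all singletons, such that the Boolean algebra $P(\kappa)/\mathcal{J}$ satisfies the countable chain condition. *)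

(* Defs.v *)
From mathcomp Require Import all_boot all_order all_algebra.
From mathcomp Require Import wochoice all_classical all_reals all_analysis.

Set Implicit Arguments.
Unset Strict Implicit.
Unset Printing Implicit Defensive.

Import Order.TTheory GRing.Theory Num.Theory.

Local Open Scope classical_set_scope.
Local Open Scope ring_scope.
Local Open Scope card_scope.

Section Polish.
Context (R : realType) (X : topologicalType).

Definition is_metric (d : X -> X -> R) : Prop :=
  [/\ forall x y, 0 <= d x y,
      forall x y, d x y = 0 <-> x = y,
      forall x y, d x y = d y x &
      forall x y z, d x z <= d x y + d y z].

Definition metrizes (d : X -> X -> R) : Prop :=
  forall x, nbhs x = filter_from [set e : R | 0 < e] (fun e => [set y | d x y < e]).

Definition complete_metric (d : X -> X -> R) : Prop :=
  forall u : nat -> X,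
    (forall e : R, 0 < e ->
       exists N, forall m n, (N <= m)%N -> (N <= n)%N -> d (u m) (u n) < e) ->
    exists x : X, u @ \oo --> x.

Definition separable : Prop := exists2 D : set X, countable D & dense D.

Definition polish_space : Prop :=
  separable /\ exists d, [/\ is_metric d, metrizes d & complete_metric d].

End Polish.

Definition Borel (X : topologicalType) : set (set X) := <<s @open X >>.

Section Ideals.
Context (T : Type).
Implicit Type I : set (set T).

Definition ideal I : Prop :=
  [/\ I set0,
      forall A B, A `<=` B -> I B -> I A &
      forall A B, I A -> I B -> I (A `|` B)].

Definition sigma_ideal I : Prop :=
  ideal I /\
  forall A : nat -> set T, (forall n, I (A n)) -> I (\bigcup_n A n).

Definition contains_singletons I : Prop := forall x, I [set x].

Definition proper_ideal I : Prop := ideal I /\ ~ I setT.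

(* The class of [A] in P(T)/I, i.e., modulo [A ~ B <-> I (A \triangle B)]. *)
Definition quotient_class I (A : set T) : set (set T) :=
  [set B | I (A `+` B)].

(* Every antichain [F] of nonzero elements of the Boolean algebra P(T)/I is
   countable; [quotient_class I set0] is its zero, and the meet of the classes
   of [A] and [B] is the class of [A `&` B]. *)
Definition quotient_ccc I : Prop :=
  forall F : set (set (set T)),
    F `<=` range (quotient_class I) ->
    ~ F (quotient_class I set0) ->
    (forall A B, F (quotient_class I A) -> F (quotient_class I B) ->
       quotient_class I A <> quotient_class I B ->
       quotient_class I (A `&` B) = quotient_class I set0) ->
    countable F.

End Ideals.

Section BorelIdeals.
Context (X : topologicalType).
Implicit Type I : set (set X).

Definition has_Borel_base I : Prop :=
  forall A, I A -> exists B, [/\ I B, Borel B & A `<=` B].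

Definition ccc_ideal I : Prop :=
  forall F : set (set X),
    F `<=` @Borel X `\` I ->
    (forall A A', F A -> F A' -> A = A' \/ I (A `&` A')) ->
    countable F.

Definition completely_nonmeasurable I (C D : set X) : Prop :=
  forall B, Borel B -> ~ I B -> ~ I (B `&` D) ->
    ~ I (B `&` C) /\ ~ I (B `&` (D `\` C)).

End BorelIdeals.

Definition card_lt (T U : Type) (A : set T) (B : set U) : Prop :=
  A #<= B /\ ~ (B #<= A).

(* Cardinals are represented by arbitrary types of that cardinality. *)
Definition kappa_additive (K : Type) (J : set (set K)) : Prop :=
  forall F : set (set K), F `<=` J -> card_lt F [set: K] ->
    J (\bigcup_(A in F) A).

Definition quasi_measurable (K : Type) : Prop :=
  ~ countable [set: K] /\
  exists J : set (set K),
    [/\ proper_ideal J, kappa_additive J, contains_singletons J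
      & quotient_ccc J].

(* [(W, le)] is a well-order of type omega_1: it is uncountable, and all its
   proper initial segments are countable. *)
Definition is_omega1 (W : Type) (le : rel W) : Prop :=
  [/\ well_order le, ~ countable [set: W]
    & forall w, countable [set v | le v w]].

Lemma omega1_exists : exists (W : Type) (le : rel W), is_omega1 le.
Proof.
have unc : ~ countable [set: set nat].
  move=> /countable_injP[f finj].
  pose D := [set n | exists2 A, f A = n & ~ A n].
  have DP : D (f D) <-> ~ D (f D).
    split=> [[A fAD] nA|nD]; last by exists D.
    have AD : A = D by apply: finj; rewrite ?in_setT.
    by rewrite -{1}AD.
  have [DnD nDD] := DP; have nD := fun h => DnD h h; exact: nD (nDD nD).
have [le wo] := well_ordering_principle (set nat : choiceType).
have wochain : wo_chain le predT by move=> A _; exact: wo.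
have anti : antisymmetric le.
  by move=> x y; apply: (wo_chain_antisymmetric wochain).
have [ctb|/existsNP[w1 w1P]] :=
  pselect (forall w, countable [set v | le v w]).
  by exists (set nat), le.
pose S := [pred w | `[< ~ countable [set v | le v w] >]].
have [w0 [[w0S w0min] _]] : exists! z, minimum_of le S z.
  by apply: wo; exists w1; apply/asboolP.
pose P v := le v w0 && (v != w0).
exists {v | P v}, (fun x y => le (val x) (val y)); split.
- move=> A [a aA].
  pose B := [pred v | `[< exists2 x : {v | P v}, x \in A & val x = v >]].
  have [|z [[/asboolP[x xA xz] zmin] _]] := wo B.
    by exists (val a); apply/asboolP; exists a.
  have xmin : lower_bound (fun x y => le (val x) (val y)) A x.
    move=> y yA; rewrite xz; apply: zmin.
    by apply/asboolP; exists y.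
  exists x; split=> // y [yA ymin].
  by apply/val_inj/anti; rewrite xmin ?ymin.
- move=> cW; move: w0S => /asboolP; apply.
  move: cW => /countable_injP[f finj]; apply/countable_injP.
  exists (fun v => if (insub v : option {v | P v}) is Some x then (f x).+1
                   else 0%N) => u v.
  have insubN z : le z w0 -> ~~ P z -> z = w0.
    by move=> zw0; rewrite /P zw0 negbK => /eqP.
  rewrite !inE/= => uw0 vw0.
  case: insubP => [x _ <-|/(insubN _ uw0) ->];
    case: insubP => [y _ <-|/(insubN _ vw0) ->] // [fxy].
  by congr val; apply: finj; rewrite ?in_setT.
- move=> w; apply: contrapT => cw.
  have /andP[lew0 /eqP] := valP w; apply; apply: anti.
  rewrite lew0/=; apply: w0min; apply/asboolP => cw'; apply: cw.
  move: cw' => /countable_injP[f finj]; apply/countable_injP.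
  exists (f \o val) => x y; rewrite !inE/= => xw yw fxy.
  by apply/val_inj/finj; rewrite ?inE.
Qed.

(* Main.v *)
Require Import Defs.
From mathcomp Require Import all_boot all_order all_algebra.
From mathcomp Require Import wochoice all_classical all_reals all_analysis.

(** Write [D] for the union of [A], and call a Borel set [B] positive if
    [B `&` D] is not in [I]. By c.c.c. there is no uncountable disjoint family
    of positive sets, so every construction that works inside each positive set
    can be exhausted in countably many steps ([ccc_exhaustion]).

    Say that [A] splits [H] if it has omega_1 disjoint subfamilies such that
    each positive subset of [H] meets uncountably many of their unions in a
    non-null set ([splits]). Grouping the subfamilies into countable blocks, one
    may then assume that each union is full in [H], i.e. has a non-null trace on
    every positive subset of [H] ([full_blocks], [splits_full]).

    Every positive [B] has a positive subset that is split by [A]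
    ([splits_below]). Consider the sigma-ideal of those subfamilies of [A]
    whose union is null in [B]. If omega_1 disjoint subfamilies lie outside of
    it, they split the part of [B] that is left after removing the regions
    where almost all of them are null. If there are no such subfamilies, let
    [kappa] be the least number of null subfamilies with a non-null union.
    Making these disjoint turns the ideal into a [kappa]-additive c.c.c. ideal
    on [kappa], so [kappa] is quasi-measurable, hence not smaller than the
    continuum ([split_or_small]). Then fewer than continuum many members of [A]
    always have a null union in [B], and since there are only continuum many
    Borel sets ([borel_enumeration]), Bernstein's transfinite construction
    applies ([bernstein_splits]).

    Countably many split regions [H n] are merged in [splits_bigcup]. Here the
    subfamilies serving different regions may overlap, and a family reserved
    for one region may be indispensable for another. But one can prepare
    uncountably many disjoint candidates for the family serving [H n]; two
    candidates that spoil the same region [H m] do so on almost disjoint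
    positive sets, so by c.c.c. all but countably many candidates spoil no
    region at all. Hence [A] splits the whole space ([splits_setT]).

    This gives disjoint subfamilies with unions that are full everywhere. Such
    a union [U xi] is completely nonmeasurable unless it covers [D] modulo [I]
    on some positive set. If that happened for uncountably many [xi], some point
    would lie in infinitely many of the [U xi], and so in infinitely many
    members of [A], against point-finiteness ([full_almost_all_nonmeasurable]).
    Discarding countably many [xi] concludes. *)

Set Implicit Arguments.
Unset Strict Implicit.
Unset Printing Implicit Defensive.

Import Order.TTheory GRing.Theory Num.Theory.

Local Open Scope classical_set_scope.
Local Open Scope card_scope.

(** * Strict well-orders and transfinite choice *)

Definition strict_wo (W : Type) (lt : W -> W -> Prop) : Prop :=
  [/\ well_founded lt,
      forall x y z, lt x y -> lt y z -> lt x z &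
      forall x y, [\/ lt x y, x = y | lt y x]].

Lemma strict_wo_of_well_order (T : Type) (le : rel T) :
  well_order le -> strict_wo (fun x y => le x y /\ x <> y).
Proof.
move=> wo.
have minP (S : set T) : S !=set0 ->
    exists2 z, S z & forall y, S y -> le z y.
  move=> [s Ss]; have [|z [[/asboolP Sz zmin] _]] := wo [pred x | `[< S x >]].
    by exists s; apply/asboolP.
  by exists z => // y Sy; apply: zmin; apply/asboolP.
have refl x : le x x.
  have [|z -> h] := minP [set x]; first by exists x.
  exact: h.
have anti x y : le x y -> le y x -> x = y.
  move=> xy yx.
  have [|z [[_ zmin] zu]] := wo [pred z | `[< z = x \/ z = y >]].
    by exists x; apply/asboolP; left.
  rewrite -(zu x) ?(zu y)//; split.
  - by apply/asboolP; right.
  - by move=> w /asboolP[] ->.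
  - by apply/asboolP; left.
  - by move=> w /asboolP[] ->.
have total x y : le x y \/ le y x.
  have [|z [->|->] h] := minP [set z | z = x \/ z = y]; first by exists x; left.
    by left; apply: h; right.
  by right; apply: h; left.
have trans x y z : le x y -> le y z -> le x z.
  move=> xy yz.
  have [|t] := minP [set t | [\/ t = x, t = y | t = z]].
    by exists x; constructor 1.
  case=> -> h.
  - by apply: h; constructor 3.
  - have -> : x = y by apply: anti => //; apply: h; constructor 1.
    exact: yz.
  - have zy : z = y by apply: anti => //; apply: h; constructor 2.
    by rewrite zy.
split.
- move=> x; apply: contrapT => nx.
  have [|z nz zmin] := minP [set x | ~ Acc (fun x y => le x y /\ x <> y) x].
    by exists x.
  apply: nz; constructor => y [yz ynz]; apply: contrapT => ny.
  by apply: ynz; apply: anti => //; apply: zmin.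
- move=> x y z [xy nxy] [yz nyz]; split; first exact: trans xy yz.
  by move=> xz; apply: nyz; apply: anti => //; rewrite -xz.
- move=> x y; have [->|nxy] := pselect (x = y); first by constructor 2.
  by have [xy|yx] := total x y; [constructor 1|constructor 3; split=> // /esym].
Qed.

Lemma exists_strict_wo (T : Type) : exists lt : T -> T -> Prop, strict_wo lt.
Proof.
have [le wo] := @well_ordering_principle {classic T}.
exists (fun x y : T => le x y /\ x <> y).
exact: (strict_wo_of_well_order wo).
Qed.

Section TransfiniteChoice.
Context (W : Type) (lt : W -> W -> Prop) (wo : strict_wo lt).

Lemma strict_wo_irr x : ~ lt x x.
Proof.
by have [wf _ _] := wo; elim: (wf x) => {}x _ IH x_x; exact: (IH _ x_x x_x).
Qed.

Lemma strict_wo_min (S : set W) :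
  S !=set0 -> exists2 z, S z & forall y, lt y z -> ~ S y.
Proof.
have [wf _ _] := wo; move=> [x]; elim: (wf x) => {}x _ IH Sx.
have [[y [yx Sy]]|nS] := pselect (exists y, lt y x /\ S y).
  exact: IH y yx Sy.
by exists x => // y yx Sy; apply: nS; exists y.
Qed.

(** The history is passed as a partial function defined exactly below [w], so
    that [G] cannot refer to values that are not yet chosen. *)
Lemma transfinite_rec (T : Type) (G : W -> (W -> option T) -> T -> Prop) :
  (forall w g, exists t, G w g t) ->
  exists h : W -> T,
    forall w, G w (fun v => if `[< lt v w >] then Some (h v) else None) (h w).
Proof.
move=> Gex; have [wf _ _] := wo.
pose c w g := projT1 (cid (Gex w g)).
have cP w g : G w g (c w g) by rewrite /c; case: cid.
pose F w (rec : forall v, lt v w -> T) : T :=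
  c w (fun v => if pselect (lt v w) is left p then Some (rec v p) else None).
exists (Fix wf (fun=> T) F) => w.
rewrite Fix_eq; last first.
  move=> x f g fg; rewrite /F; congr (c x _); apply/funext => v.
  by case: pselect => // p; rewrite fg.
rewrite {2}/F; set g := (fun v => _); set g' := (fun v => _).
suff <- : g = g' by exact: cP.
apply/funext => v; rewrite /g /g'.
by case: pselect => [p|p]; [rewrite asboolT|rewrite asboolF].
Qed.

Lemma transfinite_choice (T : Type) (t0 : T) (P : W -> T -> Prop)
    (Q : W -> W -> T -> T -> Prop) :
  (forall w (h : W -> T),
     exists t, P w t /\ forall v, lt v w -> Q v w (h v) t) ->
  exists h : W -> T, (forall w, P w (h w)) /\
    forall v w, lt v w -> Q v w (h v) (h w).
Proof.
move=> ex.
have [|h hP] := @transfinite_rec T (fun w g t =>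
    P w t /\ forall v, lt v w -> Q v w (odflt t0 (g v)) t).
  by move=> w g; have [t [Pt Qt]] := ex w (fun v => odflt t0 (g v)); exists t.
exists h; split=> [w|v w vw]; first by have [] := hP w.
by have [_ /(_ v vw)] := hP w; rewrite asboolT.
Qed.

End TransfiniteChoice.

(** * Segments and cardinalities *)

Lemma card_le_inj (T U : Type) (A : set T) (B : set U) (f : T -> U) :
  set_fun A B f -> set_inj A f -> A #<= B.
Proof. move=> fAB finj.
have [g] : $|{injfun A >-> B}| by apply/injfunPex; exists f.
exact: inj_card_le g. Qed.

Lemma card_le_injE (T U : Type) (u0 : U) (A : set T) (B : set U) :
  A #<= B -> exists2 f : T -> U, set_fun A B f & set_inj A f.
Proof. by move=> /card_leP[f]; apply/injfunPex; squash (valLR u0 f). Qed.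

Section Segments.
Context (T : Type) (lt : T -> T -> Prop) (wo : strict_wo lt).

Definition segment (E : set T) : Prop := forall x y, lt x y -> E y -> E x.

Lemma segment_lt w : segment [set v | lt v w].
Proof. by have [_ tr _] := wo; move=> x y xy /= yw; exact: tr xy yw. Qed.

(** The Mostowski collapse of [S]: sending each point of [S] to the least
    point that is not yet taken moves no point up, so [S] becomes a segment
    without leaving any segment that contains it. *)
Lemma collapse (S : set T) : exists E : set T,
  [/\ segment E, E #<= S, S #<= E &
      forall D, segment D -> S `<=` D -> E `<=` D].
Proof.
have [wf tr tot] := wo.
pose taken (g : T -> option T) : set T :=
  [set z | exists2 y, S y & g y = Some z].
have [|h hP] := @transfinite_rec _ _ wo T (fun _ g t =>
   ~` taken g !=set0 -> ~ taken g t /\ forall u, lt u t -> taken g u).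
  move=> w g; have [ne|nne] := pselect (~` taken g !=set0); last by exists w.
  have [t nt tmin] := strict_wo_min wo ne.
  by exists t => _; split=> // u /tmin /contrapT.
have {hP}hP x : (forall y, lt y x -> S y -> h y <> x) ->
    (forall y, lt y x -> S y -> h y <> h x) /\
    (forall u, lt u (h x) -> exists y, [/\ lt y x, S y & h y = u]).
  move=> hx; have [|nt tl] := hP x.
    exists x => -[y Sy]; case: asboolP => // yx [hyx].
    exact: hx yx Sy hyx.
  split=> [y yx Sy hyx|u /tl[y Sy]].
    by apply: nt; exists y => //; rewrite asboolT// hyx.
  by case: asboolP => // yx [<-]; exists y.
have hle x : h x = x \/ lt (h x) x.
  elim: (wf x) => {}x _ IH.
  have [|_ hl] := hP x.
    move=> y yx _ hyx; have [hy|] := IH _ yx.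
      by apply: (strict_wo_irr wo (x := x)); rewrite -{1}hyx hy.
    by rewrite hyx => xy; apply: (strict_wo_irr wo (x := x)); exact: tr xy yx.
  have [hx|hx|/hl[y [yx Sy hyx]]] := tot (h x) x; [by right|by left|].
  have [hy|] := IH _ yx.
    by exfalso; apply: (strict_wo_irr wo (x := x)); rewrite -{1}hyx hy.
  by rewrite hyx => /(tr _ _ _) /(_ yx) /(strict_wo_irr wo).
have {hP}hP x : (forall y, lt y x -> S y -> h y <> h x) /\
    (forall u, lt u (h x) -> exists y, [/\ lt y x, S y & h y = u]).
  apply: hP => y yx _ hyx; have [] := hle y; rewrite hyx.
    by move=> xy; apply: (strict_wo_irr wo (x := x)); rewrite {1}xy.
  by move=> xy; apply: (strict_wo_irr wo (x := x)); exact: tr xy yx.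
have hinj : set_inj S h.
  move=> x y /set_mem Sx /set_mem Sy hxy.
  have [xy|//|yx] := tot x y.
    by have [/(_ x xy Sx)] := hP y.
  by have [/(_ y yx Sy)] := hP x; rewrite hxy.
exists (h @` S); split.
- move=> u _ /[swap] -[x Sx <-] ux.
  by have [_ /(_ u ux)[y [_ Sy <-]]] := hP x; exists y.
- exact: card_image_le.
- by apply: (card_le_inj _ hinj) => x Sx; exists x.
- move=> D sD SD _ [x Sx <-]; have [->|hx] := hle x; first exact: SD.
  exact: sD hx (SD _ Sx).
Qed.

(** Cardinals are well-founded: an upward closed class of cardinals has a
    least member, realized by a segment whose proper initial segments are
    outside of the class. *)
Lemma minimal_segment (P : set (set T)) (S : set T) :
  (forall A B, A #<= B -> P A -> P B) -> P S ->
  exists E, [/\ segment E, P E, E #<= S,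
    forall v, E v -> ~ P [set u | lt u v] &
    forall A, P A -> A #<= E -> E #<= A].
Proof.
have [_ _ tot] := wo; move=> Pup PS.
have [E0 [sE0 E0S SE0 _]] := collapse S.
have [E [sE PE ES Ev]] : exists E, [/\ segment E, P E, E #<= S &
    forall v, E v -> ~ P [set u | lt u v]].
  have [ne|nne] := pselect ([set v | E0 v /\ P [set u | lt u v]] !=set0).
    have [v [E0v Pv] vmin] := strict_wo_min wo ne.
    exists [set u | lt u v]; split=> //.
    - exact: segment_lt.
    - apply: card_le_trans E0S; apply: subset_card_le => u uv.
      exact: sE0 uv E0v.
    - by move=> u /= uv Pu; apply: (vmin u uv); split=> //; exact: sE0 uv E0v.
  exists E0; split=> //; first exact: Pup SE0 PS.
  by move=> v E0v Pv; apply: nne; exists v.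
exists E; split=> // A PA AE.
have [->|/set0P[e Ee]] := eqVneq E set0; first exact: card_ge0.
have [f fE finj] := card_le_injE e AE.
have [E' [sE' E'fA fAE' E'min]] := collapse (f @` A).
have E'E : E' `<=` E by apply: E'min => // _ [a Aa <-]; exact: fE.
have PfA : A #<= f @` A by apply: (card_le_inj _ finj) => a Aa; exists a.
apply: (@card_le_trans _ _ _ E'); last first.
  exact: card_le_trans E'fA (card_image_le _ _).
apply: subset_card_le => v Ev'; apply: contrapT => nE'v; apply: (Ev v Ev').
apply: Pup (Pup _ _ (card_le_trans PfA fAE') PA).
apply: subset_card_le => u E'u /=.
have [//|uv|vu] := tot u v; first by rewrite -uv in nE'v.
by case: nE'v; exact: sE' vu E'u.
Qed.

End Segments.

(** * Sigma-ideals *)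

Section SigmaIdeals.
Context (T : Type) (I : set (set T)) (sI : sigma_ideal I).

Lemma sigma_ideal_set0 : I set0. Proof. by have [[]] := sI. Qed.

Lemma sigma_ideal_sub A B : A `<=` B -> I B -> I A.
Proof. by have [[_ sub _] _] := sI; exact: sub. Qed.

Lemma sigma_idealU A B : I A -> I B -> I (A `|` B).
Proof. by have [[_ _ U] _] := sI; exact: U. Qed.

Lemma sigma_ideal_bigcup (U : Type) (D : set U) (F : U -> set T) :
  countable D -> (forall i, D i -> I (F i)) -> I (\bigcup_(i in D) F i).
Proof.
move=> /countable_injP[f finj] IF; have [_ Ibig] := sI.
apply: (@sigma_ideal_sub _
  (\bigcup_n \bigcup_(i in [set i | D i /\ f i = n]) F i)).
  by move=> x [i Di Fix]; exists (f i) => //; exists i.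
apply: Ibig => n; have [[i [Di fi]]|ni] := pselect (exists i, D i /\ f i = n).
  apply: sigma_ideal_sub (IF i Di) => x [j [Dj fj]].
  by rewrite (finj j i) ?inE// fj.
by apply: sigma_ideal_sub sigma_ideal_set0 => x [i Di]; case: ni; exists i.
Qed.

Lemma sigma_idealD_not A B : ~ I A -> I B -> ~ I (A `\` B).
Proof.
move=> nA IB IAB; apply: nA; apply: sigma_ideal_sub (sigma_idealU IAB IB).
by move=> x Ax; have [Bx|nBx] := pselect (B x); [right|left].
Qed.

End SigmaIdeals.

(** * Combinatorics of omega_1 *)

Lemma countable_setU (T : Type) (A B : set T) :
  countable A -> countable B -> countable (A `|` B).
Proof.
by move=> cA cB; rewrite -bigcup2E; apply: bigcup_countable => // -[|[|n]].
Qed.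

Lemma countable_uncountable_ex (U : Type) (C S : set U) :
  countable C -> ~ countable S -> exists2 x, S x & ~ C x.
Proof.
move=> cC ncS; apply: contrapT => h; apply: ncS.
apply: sub_countable cC; apply: subset_card_le => x Sx.
by apply: contrapT => nCx; apply: h; exists x.
Qed.

Lemma countable_image (U V : Type) (f : U -> V) (C : set U) :
  countable C -> countable (f @` C).
Proof. by apply: sub_countable; exact: card_image_le. Qed.

Definition omega1_order (W : Type) (lt : W -> W -> Prop) : Prop :=
  [/\ strict_wo lt, ~ countable [set: W] &
      forall w, countable [set v | lt v w]].

Lemma omega1_order_of (W : Type) (le : rel W) : is_omega1 le ->
  omega1_order (fun x y => le x y /\ x <> y).
Proof.
move=> [wo ncW cW]; split.
- exact: strict_wo_of_well_order wo.
- exact: ncW.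
- by move=> w; apply: sub_countable (cW w); apply: subset_card_le => v [].
Qed.

Section Omega1.
Context (W : Type) (lt : W -> W -> Prop) (om : omega1_order lt).

Lemma omega1_inhabited : exists w : W, True.
Proof.
have [_ ncW _] := om; apply: contrapT => nW; apply: ncW.
rewrite (_ : setT = set0)//; apply/seteqP; split=> // w _.
by apply: nW; exists w.
Qed.

Lemma omega1_countable_le w : countable [set v | v = w \/ lt v w].
Proof.
have [_ _ /(_ w) cw] := om.
rewrite (_ : mkset _ = [set w] `|` [set v | lt v w]).
  by apply: countable_setU => //; exact: countable1.
by [].
Qed.

Lemma omega1_bound (C : set W) :
  countable C -> exists w, forall v, C v -> lt v w.
Proof.
move=> cC; have [[_ _ tot] ncW _] := om.
have [|w _ nw] := countable_uncountable_ex (C :=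
    \bigcup_(v in C) [set u | u = v \/ lt u v]) _ ncW.
  by apply: bigcup_countable => // v _; exact: omega1_countable_le.
exists w => v Cv; have [//|vw|wv] := tot v w.
  by case: nw; exists v => //; left.
by case: nw; exists v => //; right.
Qed.

Lemma omega1_uncountableP (E : set W) :
  ~ countable E <-> forall w, exists2 v, E v & lt w v.
Proof.
have [[_ _ tot] ncW cW] := om; split=> [ncE w|cofE cE].
  have [v Ev nv] := countable_uncountable_ex (omega1_countable_le w) ncE.
  exists v => //; have [vw|vw|//] := tot v w.
    by case: nv; right.
  by case: nv; left.
have [w Ew] := omega1_bound cE; have [v /Ew vw wv] := cofE w.
have [wo _ _] := om; have [_ tr _] := wo.
exact: (strict_wo_irr wo (tr _ _ _ vw wv)).
Qed.

Lemma omega1_inj (U : Type) (S : set U) : ~ countable S ->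
  exists2 f : W -> U, forall w, S (f w) & injective f.
Proof.
move=> ncS; have [wo _ cW] := om; have [_ _ tot] := wo.
have [u0 _ _] := countable_uncountable_ex (countable0 U) ncS.
have [|f [fS finj]] := @transfinite_choice _ _ wo _ u0 (fun _ t => S t)
    (fun _ _ s t => s <> t).
  move=> w h; have [t St nt] := countable_uncountable_ex
    (countable_image h (cW w)) ncS.
  by exists t; split=> // v vw hv; apply: nt; exists v.
exists f => // x y fxy; have [xy|//|yx] := tot x y.
  by have := finj _ _ xy.
by have := finj _ _ yx; rewrite fxy.
Qed.

(** At stage [w] one fresh point is given to each of the countably many parts
    indexed by [eta <= w]; hence every part receives a point at uncountably
    many stages. *)
Lemma omega1_parts : exists Z : W -> set W,
  (forall e, ~ countable (Z e)) /\ trivIset setT Z.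
Proof.
have [wo ncW cW] := om; have [wf tr tot] := wo.
pose low w := [set v | v = w \/ lt v w].
have [|h [hinj hdisj]] := @transfinite_choice _ _ wo _ (@id W)
    (fun w t => set_inj (low w) t)
    (fun v w s t => forall x y, low v x -> low w y -> s x <> t y).
  move=> w h.
  pose C := \bigcup_(v in [set v | lt v w]) (h v @` low v).
  have cC : countable C.
    apply: bigcup_countable => // v _.
    by apply: countable_image; exact: omega1_countable_le.
  have [|f fC finj] := @omega1_inj _ (~` C).
    move=> cnC; apply: ncW; rewrite -(setUv C).
    exact: countable_setU.
  exists f; split=> [x y _ _ /finj//|v vw x y vx wy hf].
  by apply: (fC y); exists v => //; exists x.
exists (fun e => [set h w e | w in [set w | low w e]]); split=> [e|].
  move=> cZ.
  have /countable_injP[g ginj] := cZ.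
  apply: (proj2 (omega1_uncountableP [set w | low w e])).
    move=> w; have [v ev] := omega1_bound (omega1_countable_le w).
    have wv := ev w (or_introl erefl).
    have [we|we|ew] := tot w e.
    - by exists e => //; left.
    - by exists v => //; right; rewrite -we.
    - by exists v => //; right; exact: tr ew wv.
  apply/countable_injP; exists (fun w => g (h w e)) => x y.
  rewrite !inE => xe ye gxy.
  have hxy : h x e = h y e by apply: ginj; rewrite ?inE//; [exists x|exists y].
  have [xy|//|yx] := tot x y.
    by have := hdisj _ _ xy _ _ xe ye.
  by have := hdisj _ _ yx _ _ ye xe; rewrite hxy.
move=> e e' _ _ [_ [[x xe <-] [y ye' hyx]]].
have [xy|xy|yx] := tot x y.
- by have := hdisj _ _ xy _ _ xe ye'; rewrite hyx.
- subst y; by apply: (hinj x); rewrite ?inE.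
- by have := hdisj _ _ yx _ _ ye' xe; rewrite hyx.
Qed.

(** Subtracting the earlier sets makes an almost disjoint omega_1-sequence
    disjoint, at the cost of countably many null sets for each term. *)
Lemma omega1_disjointify (T : Type) (J : set (set T)) (Z : W -> set T) :
  sigma_ideal J -> (forall w, ~ J (Z w)) ->
  (forall v w, v <> w -> J (Z v `&` Z w)) ->
  let Z' w := Z w `\` \bigcup_(v in [set v | lt v w]) Z v in
  (forall w, ~ J (Z' w)) /\ trivIset setT Z'.
Proof.
move=> sJ nZ ZZ Z'; have [wo _ cW] := om; have [_ _ tot] := wo; split.
  move=> w JZ'; apply: (nZ w).
  have JU : J (\bigcup_(v in [set v | lt v w]) (Z v `&` Z w)).
    apply: sigma_ideal_bigcup => // v vw; apply: ZZ => vw'.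
    by move: vw; rewrite vw' => /(strict_wo_irr wo).
  apply: (sigma_ideal_sub sJ _ (sigma_idealU sJ JZ' JU)) => x Zx.
  have [[v vw Zv]|n] := pselect ((\bigcup_(v in [set v | lt v w]) Z v) x).
    by right; exists v.
  by left.
move=> v w _ _ [x [[Zv nv] [Zw nw]]]; have [vw|//|wv] := tot v w.
  by case: nw; exists v.
by case: nv; exists w.
Qed.

End Omega1.

(** * Borel sets are enumerated by the Cantor space *)

Inductive borel_code : Type :=
| BasicCode of nat
| ComplCode of borel_code
| UnionCode of (nat -> borel_code).

Fixpoint borel_eval (X : Type) (V : nat -> set X) (c : borel_code) : set X :=
  match c with
  | BasicCode n => V n
  | ComplCode c => ~` borel_eval V c
  | UnionCode f => \bigcup_n borel_eval V (f n)
  end.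

(** A code is a well-founded tree, determined by the labels of its nodes. The
    label of a leaf is repeated at all positions below it. *)
Fixpoint code_label (c : borel_code) (s : seq nat) : nat :=
  match c with
  | BasicCode n => n.+2
  | ComplCode c => if s is _ :: s' then code_label c s' else 0%N
  | UnionCode f => if s is n :: s' then code_label (f n) s' else 1%N
  end.

Lemma code_label_inj : injective code_label.
Proof.
elim=> [n|c IH|f IH] [m|d|g] e.
- by have [->] := congr1 (@^~ [::]) e.
- by have := congr1 (@^~ [::]) e.
- by have := congr1 (@^~ [::]) e.
- by have := congr1 (@^~ [::]) e.
- congr ComplCode; apply: IH; apply/funext => s.
  exact: (congr1 (@^~ (0%N :: s)) e).
- by have := congr1 (@^~ [::]) e.
- by have := congr1 (@^~ [::]) e.
- by have := congr1 (@^~ [::]) e.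
- congr UnionCode; apply/funext => n; apply: IH; apply/funext => s.
  exact: (congr1 (@^~ (n :: s)) e).
Qed.

Lemma borel_code_inj : exists f : borel_code -> nat -> bool, injective f.
Proof.
exists (fun c n =>
  if unpickle n is Some (s, k) then code_label c s == k else false).
move=> c d e; apply: code_label_inj; apply/funext => s; apply/esym/eqP.
have := congr1 (@^~ (pickle (s, code_label c s))) e.
by rewrite /= pickleK eqxx => <-.
Qed.

Section BorelEnumeration.
Context (R : realType) (X : topologicalType).

(** Balls of radius [1/(k+1)] centered in the dense set; the balls with index
    [(m, k)] are those whose center is numbered [m]. *)
Lemma polish_countable_base : polish_space R X -> exists V : nat -> set X,
  (forall n, open (V n)) /\
  forall U x, open U -> U x -> exists n, V n x /\ V n `<=` U.
Proof.
move=> [[D cD dD] [d [[d0 dE dC dT] dN _]]].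
have /countable_injP[f finj] := cD.
pose ball (x : X) (k : nat) := [set y | d x y < k.+1%:R^-1]%R.
have oball x k : open (ball x k).
  rewrite openE => y xy; rewrite /interior dN.
  exists (k.+1%:R^-1 - d x y)%R; first by rewrite /= subr_gt0.
  move=> z /= yz; apply: le_lt_trans (dT x y z) _.
  by rewrite addrC -ltrBrDr.
pose V n := if unpickle n is Some (m, k) then
  \bigcup_(x in [set x | D x /\ f x = m]) ball x k else set0.
exists V; split=> [n|U x oU Ux].
  rewrite /V; case: unpickle => [[m k]|]; last exact: open0.
  by apply: bigcup_open => x _; exact: oball.
have : nbhs x U by apply: open_nbhs_nbhs; split.
rewrite dN => -[e /= e0 eU].
have [k ke] : exists k : nat, (k.+1%:R^-1 < e / 2)%R.
  have e2 : (0 < e / 2)%R by rewrite divr_gt0.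
  by have [k] := ltr_add_invr e2; rewrite add0r => ?; exists k.
have bx : ball x k x by rewrite /ball /= (proj2 (dE x x)).
have [y [xy Dy]] := dD (ball x k) (ex_intro _ x bx) (oball x k).
exists (pickle (f y, k)); rewrite /V pickleK; split.
  by exists y => //; rewrite /ball/= dC.
move=> z [y' [Dy' fy']]; rewrite (finj y' y) ?inE// => yz.
apply: eU => /=; apply: le_lt_trans (dT x y z) _.
by rewrite (splitr e) ltrD//; exact: lt_trans ke.
Qed.

Lemma borel_enumeration : polish_space R X ->
  exists E : (nat -> bool) -> set X, @Borel X `<=` range E.
Proof.
move=> /polish_countable_base[V [oV baseV]].
have [f finj] := borel_code_inj.
have [c0 c0E] : exists c, borel_eval V c = set0.
  exists (ComplCode (UnionCode (fun n =>
    if n is 0%N then BasicCode 0 else ComplCode (BasicCode 0)))).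
  apply/seteqP; split=> // x /= nx; apply: nx.
  by have [Vx|nVx] := pselect (V 0%N x); [exists 0%N|exists 1%N].
suff evalB : @Borel X `<=` range (borel_eval V).
  have /choice[E EP] : forall b, exists B,
      forall c, f c = b -> borel_eval V c = B.
    move=> b; have [[c fc]|nc] := pselect (exists c, f c = b).
      by exists (borel_eval V c) => c'; rewrite -fc => /finj ->.
    by exists set0 => c fc; case: nc; exists c.
  by exists E => B /evalB[c _ <-]; exists (f c) => //; rewrite -(EP _ c).
apply: smallest_sub; last first.
  move=> U oU.
  exists (UnionCode (fun n =>
    if `[< V n `<=` U >] then BasicCode n else c0)) => //.
  apply/seteqP; split=> [x [n _] /=|x Ux].
    by case: asboolP => [VU /VU//|_]; rewrite -/(borel_eval V c0) c0E.
  have [n [Vnx VU]] := baseV U x oU Ux.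
  by exists n => //; rewrite asboolT.
split.
- by exists c0.
- by move=> A [c _ <-]; exists (ComplCode c) => //=; rewrite setTD.
- move=> A AP; have /choice[c cP] : forall n, exists c, borel_eval V c = A n.
    by move=> n; have [c _ <-] := AP n; exists c.
  by exists (UnionCode c) => //=; apply: eq_bigcupr => n _.
Qed.

End BorelEnumeration.

(** * Exhaustion by Borel sets *)

Section BorelSets.
Context (X : topologicalType).

Lemma Borel_set0 : Borel (@set0 X). Proof. exact: sigma_algebra0. Qed.

Lemma Borel_setC (B : set X) : Borel B -> Borel (~` B).
Proof. by move=> bB; rewrite -setTD; exact: sigma_algebraCD. Qed.

Lemma Borel_setT : Borel [set: X].
Proof. by rewrite -setC0; apply: Borel_setC; exact: Borel_set0. Qed.

Lemma Borel_bigcup (B : nat -> set X) :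
  (forall n, Borel (B n)) -> Borel (\bigcup_n B n).
Proof. exact: sigma_algebra_bigcup. Qed.

Lemma Borel_setU (A B : set X) : Borel A -> Borel B -> Borel (A `|` B).
Proof.
move=> bA bB; rewrite -bigcup2E; apply: Borel_bigcup => -[|[|n]] //=.
exact: Borel_set0.
Qed.

Lemma Borel_setI (A B : set X) : Borel A -> Borel B -> Borel (A `&` B).
Proof.
move=> bA bB; rewrite -[A `&` B]setCK setCI; apply: Borel_setC.
by apply: Borel_setU; exact: Borel_setC.
Qed.

Lemma Borel_setD (A B : set X) : Borel A -> Borel B -> Borel (A `\` B).
Proof.
by move=> bA bB; rewrite setDE; apply: Borel_setI => //; exact: Borel_setC.
Qed.

Lemma Borel_bigcup_countable (U : Type) (C : set U) (F : U -> set X) :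
  countable C -> (forall i, C i -> Borel (F i)) -> Borel (\bigcup_(i in C) F i).
Proof.
move=> /countable_injP[f finj] BF.
have -> : \bigcup_(i in C) F i =
    \bigcup_n \bigcup_(i in [set i | C i /\ f i = n]) F i.
  apply/seteqP; split=> [x [i Ci Fx]|x [n _ [i [Ci _] Fx]]]; last by exists i.
  by exists (f i) => //; exists i.
apply: Borel_bigcup => n.
have [[i [Ci fi]]|ni] := pselect (exists i, C i /\ f i = n).
  rewrite (_ : bigcup _ _ = F i); first exact: BF.
  apply/seteqP; split=> [x [j [Cj fj]]|x Fx]; last by exists i.
  by rewrite (finj j i) ?inE// fj.
rewrite (_ : bigcup _ _ = set0); first exact: Borel_set0.
by apply/seteqP; split=> // x [i Ci]; case: ni; exists i.
Qed.

End BorelSets.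

Section Positive.
Context (X : topologicalType) (I : set (set X)) (D : set X).

Definition positive (B : set X) : Prop := Borel B /\ ~ I (B `&` D).

(** For [Y] contained in [D]: inside [H], the sets [Y] and [D] have the same
    Borel hull modulo [I]. *)
Definition full (Y H : set X) : Prop :=
  forall B, positive B -> B `<=` H -> ~ I (B `&` Y).

(** Fullness of all [Y w] in [H] is the goal; this weaker property is what
    exhaustion yields, and null terms of the sequence do not affect it. *)
Definition cofinally_positive (W : Type) (Y : W -> set X) (H : set X) : Prop :=
  forall B, positive B -> B `<=` H -> ~ countable [set w | ~ I (B `&` Y w)].

Context (sI : sigma_ideal I).

Lemma full_sub Y Z H : Y `<=` Z -> full Y H -> full Z H.
Proof.
move=> YZ fY B pB BH IBZ; apply: (fY B pB BH).
by apply: (sigma_ideal_sub sI _ IBZ); exact: setIS.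
Qed.

Context (cI : ccc_ideal I).

(** A maximal disjoint family of positive members of [P] is countable. *)
Lemma ccc_exhaustion (P : set (set X)) : P `<=` @Borel X ->
  exists H : nat -> set X, (forall n, P (H n) \/ H n = set0) /\
    forall B, P B -> (forall n, B `&` H n = set0) -> I (B `&` D).
Proof.
move=> PB.
have [E [EP triE Emax]] := ex_maximal_disjoint_subcollection
  id [set B | P B /\ ~ I (B `&` D)].
have /countable_injP[f finj] : countable E.
  apply: cI => [B /EP[PBB nI]|B B' EB EB'].
    split; first exact: PB.
    move=> IB; apply: nI; apply: (sigma_ideal_sub sI _ IB); exact: subIsetl.
  have [->|BB'] := pselect (B = B'); [by left|right].
  rewrite (_ : B `&` B' = set0); first exact: sigma_ideal_set0.
  by apply: contrapT => /eqP/set0P ne; apply: BB'; exact: triE ne.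
have /choice[H HP] : forall n, exists H, (E H \/ H = set0) /\
    forall B, E B -> f B = n -> B = H.
  move=> n; have [[B [EB fB]]|nB] := pselect (exists B, E B /\ f B = n).
    by exists B; split=> [|B' EB' fB']; [left|apply: finj; rewrite ?inE// fB].
  by exists set0; split=> [|B EB fB]; [right|case: nB; exists B].
exists H; split=> [n|B PBB dB].
  by have [[/EP[PH _]|H0] _] := HP n; [left|right].
apply: contrapT => nIB.
have EdB B' : E B' -> B `&` B' = set0.
  by move=> EB'; rewrite (proj2 (HP (f B')) _ EB' erefl).
apply: (Emax (B |` E)).
- split; first by move=> B' EB'; right.
  move=> /(_ B (or_introl erefl)) /EdB; rewrite setIid => B0.
  by apply: nIB; rewrite B0 set0I; exact: sigma_ideal_set0.
- by move=> B' [->//|/EP].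
- move=> B1 B2 [->|EB1] [->|EB2]//.
  + by rewrite /= (EdB _ EB2) => -[].
  + by rewrite /= setIC (EdB _ EB1) => -[].
  + exact: triE.
Qed.

(** The part of [B] that is left by exhausting the Borel sets in which [Y] is
    null. *)
Lemma full_hull (Y B : set X) : Y `<=` D -> Borel B -> ~ I (B `&` Y) ->
  exists B', [/\ positive B', B' `<=` B & full Y B'].
Proof.
move=> YD bB nBY.
have [|H [HP Hmax]] := @ccc_exhaustion
  [set B' | [/\ Borel B', B' `<=` B & I (B' `&` Y)]]; first by move=> ? [].
have bH : Borel (\bigcup_n H n).
  by apply: Borel_bigcup => n; have [[]//|->] := HP n; exact: Borel_set0.
have IHY : I ((\bigcup_n H n) `&` Y).
  rewrite setI_bigcupl; have [_ sIb] := sI; apply: sIb => n.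
  have [[]//|->] := HP n; rewrite set0I; exact: sigma_ideal_set0.
exists (B `\` \bigcup_n H n); split.
- split; first exact: Borel_setD.
  move=> Ir; apply: (sigma_idealD_not sI nBY IHY).
  apply: (sigma_ideal_sub sI _ Ir) => x [[Bx Yx] nHY].
  by split; [split=> // Hx; apply: nHY|exact: YD].
- by move=> x [].
- move=> B' [bB' nB'] B'B IB'Y; apply: nB'; apply: Hmax.
    by split=> // x /B'B[].
  move=> n; apply/seteqP; split=> // x [/B'B[_ nH] Hx].
  by apply: nH; exists n.
Qed.

Context (W : Type) (lt : W -> W -> Prop) (om : omega1_order lt).

(** The part of [B] that is left by exhausting the Borel sets in which all but
    countably many [Y w] are null. *)
Lemma cofinally_positive_part (Y : W -> set X) (B : set X) :
  (forall w, Y w `<=` D) -> Borel B -> (forall w, ~ I (B `&` Y w)) ->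
  exists H, [/\ positive H, H `<=` B & cofinally_positive Y H].
Proof.
move=> YD bB nBY.
have [|H [HP Hmax]] := @ccc_exhaustion
  [set B' | [/\ Borel B', B' `<=` B & countable [set w | ~ I (B' `&` Y w)]]].
  by move=> ? [].
have bH : Borel (\bigcup_n H n).
  by apply: Borel_bigcup => n; have [[]//|->] := HP n; exact: Borel_set0.
have cH : countable (\bigcup_n [set w | ~ I (H n `&` Y w)]).
  apply: bigcup_countable => // n _; have [[]//|->] := HP n.
  rewrite (_ : mkset _ = set0)//; apply/seteqP; split=> // w /=.
  by apply; rewrite set0I; exact: sigma_ideal_set0.
have [_ ncW _] := om.
have [w _ nw] := countable_uncountable_ex cH ncW.
have IHY : I ((\bigcup_n H n) `&` Y w).
  rewrite setI_bigcupl; have [_ sIb] := sI; apply: sIb => n.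
  by apply: contrapT => nI; apply: nw; exists n.
exists (B `\` \bigcup_n H n); split.
- split; first exact: Borel_setD.
  move=> Ir; apply: (sigma_idealD_not sI (nBY w) IHY).
  apply: (sigma_ideal_sub sI _ Ir) => x [[Bx Yx] nHY].
  by split; [split=> // Hx; apply: nHY|exact: YD Yx].
- by move=> x [].
- move=> B' [bB' nB'] B'B cB'Y; apply: nB'; apply: Hmax.
    by split=> // x /B'B[].
  move=> n; apply/seteqP; split=> // x [/B'B[_ nH] Hx].
  by apply: nH; exists n.
Qed.

(** Exhaust [H] by regions in which a single [Y w], with [w] outside of [K], is
    full; countably many regions need only countably many [w]. *)
Lemma full_countable_union (Y : W -> set X) (H : set X) (K : set W) :
  (forall w, Y w `<=` D) -> cofinally_positive Y H -> countable K ->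
  exists C : set W, [/\ countable C, C `&` K = set0 &
    full (\bigcup_(w in C) Y w) H].
Proof.
move=> YD cpY cK.
have [|F [FP Fmax]] := @ccc_exhaustion
  [set B | Borel B /\ exists2 w, ~ K w & full (Y w) B]; first by move=> ? [].
have bF n : Borel (F n) by have [[]//|->] := FP n; exact: Borel_set0.
have /choice[c cP] : forall n, exists C : set W,
    [/\ countable C, C `&` K = set0 &
      F n = set0 \/ exists2 w, C w & full (Y w) (F n)].
  move=> n; have [[_ [w Kw fw]]|F0] := FP n.
    exists [set w]; split; [exact: countable1| |by right; exists w].
    by apply/seteqP; split=> // x [->].
  by exists set0; split; [exact: countable0|rewrite set0I|left].
exists (\bigcup_n c n); split.
- by apply: bigcup_countable => // n _; have [] := cP n.
- rewrite setI_bigcupl; apply/seteqP; split=> // x [n _].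
  by have [_ -> _] := cP n.
move=> B pB BH IBY; have [bB nB] := pB.
have bU : Borel (B `\` \bigcup_n F n).
  by apply: Borel_setD => //; exact: Borel_bigcup.
have IU : I ((B `\` \bigcup_n F n) `&` D).
  apply: contrapT => nU.
  have [|w nIw Kw] := countable_uncountable_ex cK (cpY _ (conj bU nU) _).
    by move=> x [/BH].
  have [B' [pB' B'U fB']] := full_hull (YD w) bU nIw.
  have [bB' nB'] := pB'; apply: nB'; apply: Fmax.
    by split=> //; exists w.
  move=> n; apply/seteqP; split=> // x [/B'U[_ nF] Fx].
  by apply: nF; exists n.
have [n nIn] : exists n, ~ I (B `&` F n `&` D).
  apply: contrapT => /forallNP nn; apply: nB.
  have IF : I (\bigcup_n (B `&` F n `&` D)).
    by have [_ sIb] := sI; apply: sIb => n; apply: contrapT.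
  apply: (sigma_ideal_sub sI _ (sigma_idealU sI IU IF)) => x [Bx Dx].
  have [[n _ Fx]|nFx] := pselect ((\bigcup_n F n) x); last by left.
  by right; exists n.
have [_ _ [F0|[w cw fw]]] := cP n.
  by apply: nIn; rewrite F0 setI0 set0I; exact: sigma_ideal_set0.
apply: (fw (B `&` F n)) => //; first by split=> //; exact: Borel_setI.
apply: (sigma_ideal_sub sI _ IBY) => x [[Bx Fx] Yx]; split=> //.
by exists w => //; exists n.
Qed.

Lemma full_blocks (Y : W -> set X) (H : set X) :
  (forall w, Y w `<=` D) -> cofinally_positive Y H ->
  exists C : W -> set W, [/\ forall w, countable (C w), trivIset setT C &
    forall w, full (\bigcup_(v in C w) Y v) H].
Proof.
move=> YD cpY; have [wo _ cW] := om; have [_ _ tot] := wo.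
have [|C [CP Cdisj]] := @transfinite_choice _ _ wo _ (@set0 W)
    (fun _ C => countable C /\ full (\bigcup_(v in C) Y v) H)
    (fun _ _ C C' => countable C -> C' `&` C = set0).
  move=> w h.
  pose K := \bigcup_(v in [set v | lt v w /\ countable (h v)]) h v.
  have cK : countable K.
    apply: bigcup_countable => [|v []//].
    by apply: sub_countable (cW w); apply: subset_card_le => v [].
  have [C [cC CK fC]] := full_countable_union YD cpY cK.
  exists C; split=> // v vw cv; apply/seteqP; split=> // x [Cx hx].
  by rewrite -CK; split=> //; exists v.
exists C; split=> [w||w]; [by have [] := CP w| |by have [] := CP w].
move=> v w _ _ [x [Cv Cw]]; have [vw|//|wv] := tot v w.
  by have /seteqP[/(_ x) h _] := Cdisj _ _ vw (CP v).1; case: h.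
by have /seteqP[/(_ x) h _] := Cdisj _ _ wv (CP w).1; case: h.
Qed.

(** Almost disjoint positive sets could be made disjoint, against c.c.c. *)
Lemma positive_pigeonhole (B : W -> set X) : (forall w, positive (B w)) ->
  exists v w, v <> w /\ positive (B v `&` B w).
Proof.
move=> pB; apply: contrapT => nB; have [wo ncW cW] := om.
have sJ : sigma_ideal [set A | I (A `&` D)].
  split; first split.
  - by rewrite /= set0I; exact: sigma_ideal_set0.
  - move=> A A' AA' /= IA'; apply: (sigma_ideal_sub sI _ IA'); exact: setSI.
  - by move=> A A' /= IA IA'; rewrite setIUl; exact: sigma_idealU.
  - by move=> A /= IA; rewrite setI_bigcupl; have [_ ] := sI; exact.
pose Z w := B w `\` \bigcup_(v in [set v | lt v w]) B v.
have [nZ triZ] : (forall w, ~ I (Z w `&` D)) /\ trivIset setT Z.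
  apply: (omega1_disjointify om sJ) => [w|v w vw /=]; first by have [] := pB w.
  apply: contrapT => nI; apply: nB; exists v, w; split=> //.
  by split=> //; apply: Borel_setI; [have [] := pB v|have [] := pB w].
have Zinj : injective Z.
  move=> v w Zvw; apply: triZ => //; rewrite -Zvw setIid; apply/set0P/eqP => Z0.
  by apply: (nZ v); rewrite Z0 set0I; exact: sigma_ideal_set0.
have cZ : countable (range Z).
  apply: cI => [_ [w _ <-]|_ _ [v _ <-] [w _ <-]].
    split.
      apply: Borel_setD; first by have [] := pB w.
      by apply: Borel_bigcup_countable => // v _; have [] := pB v.
    move=> IZ; apply: (nZ w); apply: (sigma_ideal_sub sI _ IZ); exact: subIsetl.
  have [->|vw] := pselect (v = w); [by left|right].
  rewrite (_ : _ `&` _ = set0); first exact: sigma_ideal_set0.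
  by apply: contrapT => /eqP/set0P ne; apply: vw; exact: triZ ne.
apply: ncW; apply: sub_countable cZ.
by apply: (card_le_inj (f := Z)) => [w _|v w _ _ /Zinj//]; exists w.
Qed.

End Positive.

(** * Splitting a family into omega_1 subfamilies *)

Section Splitting.
Context (X : topologicalType) (I : set (set X)) (A : set (set X)).
Context (W : Type) (lt : W -> W -> Prop) (om : omega1_order lt).
Context (sI : sigma_ideal I) (cI : ccc_ideal I).

Local Notation D := (\bigcup_(B in A) B).

Definition splits (A' : set (set X)) (H : set X) : Prop :=
  exists S : W -> set (set X),
    [/\ forall w, S w `<=` A', trivIset setT S &
        cofinally_positive I D (fun w => \bigcup_(B in S w) B) H].

(** Grouping into countable blocks removes the weakness of the definition. *)
Lemma splits_full A' H : A' `<=` A -> splits A' H ->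
  exists S : W -> set (set X),
    [/\ forall w, S w `<=` A', trivIset setT S &
        forall w, full I D (\bigcup_(B in S w) B) H].
Proof.
move=> A'A [S [SA' triS cpS]].
have [|C [cC triC fC]] := full_blocks sI cI om _ cpS.
  by move=> w x [B /SA' /A'A AB Bx]; exists B.
exists (fun w => \bigcup_(v in C w) S v); split=> [w B [v _ /SA']//| |w].
- move=> v w _ _ [B [[v' Cv Sv] [w' Cw Sw]]].
  have vw' : v' = w' by apply: triS => //; exists B.
  by apply: triC => //; exists v'; split=> //; rewrite vw'.
- apply: (full_sub sI _ (fC w)) => x [v Cv [B SB Bx]].
  by exists B => //; exists v.
Qed.

(** The candidates [T e] for the subfamily are disjoint, so a family that is
    full in [H m] is the union of what remains after deleting [T e] and after
    deleting [T e']. Hence the two deletions cannot both be harmful on one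
    positive set, and only countably many [e] are harmful for some [m]. *)
Lemma splits_step (H : nat -> set X) A' n : A' `<=` A ->
  (forall m, splits A' (H m)) ->
  exists S, [/\ S `<=` A', splits S (H n) & forall m, splits (A' `\` S) (H m)].
Proof.
move=> A'A sA'.
have /choice[F FP] := fun m => splits_full A'A (sA' m).
have [Z [ncZ triZ]] := omega1_parts om.
pose T e := \bigcup_(w in Z e) F n w.
have TA' e : T e `<=` A' by move=> B [w _]; have [FA' _ _] := FP n; exact: FA'.
have triT e e' B : T e B -> T e' B -> e = e'.
  move=> [w Zw FB] [w' Zw' FB']; have [_ triF _] := FP n.
  have ww' : w = w' by apply: triF => //; exists B.
  by apply: triZ => //; exists w; split=> //; rewrite ww'.
have sT e : splits (T e) (H n).
  have [_ triF fF] := FP n.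
  exists (fun w => [set B | Z e w /\ F n w B]); split.
  - by move=> w B [Zw FB]; exists w.
  - by move=> v w _ _ [B [[_ FB] [_ FB']]]; apply: triF => //; exists B.
  - move=> B pB BH cB; apply: (ncZ e); apply: sub_countable cB.
    apply: subset_card_le => w Zw IB; apply: (fF w B pB BH).
    apply: (sigma_ideal_sub sI _ IB); apply: setIS => x [B' FB' B'x].
    by exists B'.
have cbad m : countable [set e | ~ splits (A' `\` T e) (H m)].
  apply: contrapT => ncbad; have [f fbad finj] := omega1_inj om ncbad.
  have [FA' triF fF] := FP m.
  have /choice[B BP] : forall w, exists B, [/\ positive I D B, B `<=` H m &
      countable [set v | ~ I (B `&` \bigcup_(B in F m v `\` T (f w)) B)]].
    move=> w; apply: contrapT => nB; apply: (fbad w).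
    exists (fun v => F m v `\` T (f w)); split.
    - by move=> v B [/FA'].
    - by move=> v v' _ _ [B [[FB _] [FB' _]]]; apply: triF => //; exists B.
    - by move=> B pB BH cB; apply: nB; exists B.
  have [v [w [vw pvw]]] : exists v w, v <> w /\ positive I D (B v `&` B w).
    by apply: (positive_pigeonhole sI cI om) => w; have [] := BP w.
  have [_ BvH cv] := BP v; have [_ _ cw] := BP w.
  have [_ ncW _] := om.
  have [u _ nu] := countable_uncountable_ex (countable_setU cv cw) ncW.
  have /not_orP[/contrapT Iv /contrapT Iw] := nu.
  apply: (fF u _ pvw) => [x [/BvH]//|].
  apply: (sigma_ideal_sub sI _ (sigma_idealU sI Iv Iw)).
  move=> x [[Bv Bw] [C FC Cx]].
  have [TC|nTC] := pselect (T (f v) C); last by left; split=> //; exists C.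
  right; split=> //; exists C => //; split=> // TC'.
  by apply/vw/finj; exact: triT TC TC'.
have cbads : countable (\bigcup_m [set e | ~ splits (A' `\` T e) (H m)]).
  by apply: bigcup_countable => // m _.
have [_ ncW _] := om; have [e _ ne] := countable_uncountable_ex cbads ncW.
exists (T e); split=> // m; apply: contrapT => nm; apply: ne.
by exists m.
Qed.

(** Reserve one after the other a subfamily [S n] for [H n], each time leaving a
    rest that still splits every region; a member of the final sequence takes
    one piece from each [S n]. *)
Lemma splits_bigcup (H : nat -> set X) A' : A' `<=` A ->
  (forall n, Borel (H n)) -> (forall n, splits A' (H n)) ->
  splits A' (\bigcup_n H n).
Proof.
move=> A'A bH sA'.
pose Q A' := A' `<=` A /\ forall m, splits A' (H m).
have /choice[c cP] : forall p : set (set X) * nat, exists S, Q p.1 ->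
    [/\ S `<=` p.1, splits S (H p.2) & Q (p.1 `\` S)].
  move=> [A1 n] /=; have [[A1A sA1]|nQ] := pselect (Q A1); last by exists set0.
  have [S [SA1 sS sA1S]] := splits_step n A1A sA1.
  by exists S => _; split=> //; split=> // B [/A1A].
pose fix rest n := if n is n'.+1 then rest n' `\` c (rest n', n') else A'.
pose S n := c (rest n, n).
have Qrest n : Q (rest n) by elim: n => [//|n IH]; have [] := cP (rest n, n) IH.
have Srest n : S n `<=` rest n by have [] := cP (rest n, n) (Qrest n).
have rest_sub m n : rest (m + n)%N `<=` rest n.
  by elim: m => [//|m IH] B [/IH].
have Sdisj m n B : (m < n)%N -> S m B -> ~ S n B.
  move=> mn SmB /Srest; rewrite -(subnK mn) => /rest_sub[_ nS]; exact: nS.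
have SA' n : S n `<=` A'.
  by move=> B /Srest; rewrite -{1}[n]addn0 => /rest_sub.
have /choice[G GP] : forall n, splits (S n) (H n).
  by move=> n; have [] := cP (rest n, n) (Qrest n).
exists (fun w => \bigcup_n G n w); split.
- by move=> w B [n _]; have [GS _ _] := GP n => /GS /SA'.
- move=> v w _ _ [B [[n _ GB] [m _ GB']]].
  have [GSn triG _] := GP n; have [GSm _ _] := GP m.
  have [nm|mn|nm] := ltngtP n m.
  + by have := Sdisj _ _ _ nm (GSn _ _ GB) (GSm _ _ GB').
  + by have := Sdisj _ _ _ mn (GSm _ _ GB') (GSn _ _ GB).
  + by apply: triG => //; exists B; split=> //; rewrite nm.
move=> B pB BH cB; have [bB nB] := pB.
have [n nIn] : exists n, ~ I (B `&` H n `&` D).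
  apply: contrapT => /forallNP nn; apply: nB.
  have IF : I (\bigcup_n (B `&` H n `&` D)).
    by have [_ sIb] := sI; apply: sIb => n; apply: contrapT.
  apply: (sigma_ideal_sub sI _ IF) => x [Bx Dx].
  by have [n _ Hx] := BH x Bx; exists n.
have [_ _ cpG] := GP n.
apply: (cpG (B `&` H n)); [by split=> //; exact: Borel_setI|by move=> x []|].
apply: sub_countable cB; apply: subset_card_le => w nw IB; apply: nw.
apply: (sigma_ideal_sub sI _ IB) => x [[Bx _] [C GC Cx]]; split=> //.
by exists C => //; exists n.
Qed.

(** Let [f w] enumerate uncountably many failures, the union of [S (f w)]
    covering [D] modulo [I] on a positive set [B w]. Infinitely many disjoint
    blocks of the sets [B w] each cover [D] modulo [I] on a common positive set,
    so some point lies in infinitely many of the unions, hence in infinitely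
    many members of [A]. *)
Lemma full_almost_all_nonmeasurable (S : W -> set (set X)) :
  (forall x : X, finite_set [set B | A B /\ B x]) ->
  (forall w, S w `<=` A) -> trivIset setT S ->
  (forall w, full I D (\bigcup_(B in S w) B) setT) ->
  countable [set w | ~ completely_nonmeasurable I (\bigcup_(B in S w) B) D].
Proof.
move=> finA SA triS fS; apply: contrapT => ncbad.
have [f fbad finj] := omega1_inj om ncbad.
have /choice[B BP] : forall w, exists B, positive I D B /\
    I (B `&` (D `\` \bigcup_(B in S (f w)) B)).
  move=> w; apply: contrapT => nB; apply: (fbad w) => B bB _ nIB; split.
    by apply: fS.
  by move=> IB; apply: nB; exists B.
pose Y w := B w `&` D.
have YD w : Y w `<=` D by move=> x [].
have [|H [pH _ cpY]] := cofinally_positive_part sI cI om YD (@Borel_setT X).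
  by move=> w; rewrite setTI; have [[]] := BP w.
have [C [cC triC fC]] := full_blocks sI cI om YD cpY.
have [g _ ginj] : exists2 g : nat -> W, set_fun setT setT g & set_inj setT g.
  have [w0 _] := omega1_inhabited om; apply: card_le_injE => //.
  apply/infiniteP => finW; have [_ ncW _] := om; apply: ncW.
  exact: finite_set_countable.
have [bH nH] := pH.
(* The exceptional points: those missed by a whole block, and those that some
   [S (f v)] fails to cover inside [B v]. *)
have IN1 : I (\bigcup_n (H `&` D `\` \bigcup_(v in C (g n)) Y v)).
  have [_ sIb] := sI; apply: sIb => n; apply: contrapT => nI.
  pose B' := H `\` \bigcup_(v in C (g n)) B v.
  have B'D : B' `&` D = H `&` D `\` \bigcup_(v in C (g n)) Y v.
    apply/seteqP; split=> [x [[Hx nB] Dx]|x [[Hx Dx] nY]].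
      by split=> // -[v Cv [Bx _]]; apply: nB; exists v.
    by split=> //; split=> // -[v Cv Bx]; apply: nY; exists v.
  apply: (fC (g n) B'); last 1 first.
  - rewrite (_ : _ `&` _ = set0); first exact: sigma_ideal_set0.
    apply/seteqP; split=> // x [[_ nB] [v Cv [Bx _]]].
    by apply: nB; exists v.
  - split; last by rewrite B'D.
    apply: Borel_setD => //; apply: Borel_bigcup_countable => // v _.
    by have [[]] := BP v.
  - by move=> x [].
have IN2 : I (\bigcup_n \bigcup_(v in C (g n))
    (B v `&` (D `\` \bigcup_(B in S (f v)) B))).
  have [_ sIb] := sI; apply: sIb => n.
  by apply: sigma_ideal_bigcup => // v _; have [] := BP v.
have [x [Hx Dx] nN] : exists2 x, (H `&` D) x & ~ (
    (\bigcup_n (H `&` D `\` \bigcup_(v in C (g n)) Y v)) x \/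
    (\bigcup_n \bigcup_(v in C (g n))
      (B v `&` (D `\` \bigcup_(B in S (f v)) B))) x).
  apply: contrapT => nx; apply: nH.
  apply: (sigma_ideal_sub sI _ (sigma_idealU sI IN1 IN2)) => x HDx.
  by apply: contrapT => nxx; apply: nx; exists x.
have /choice[h hP] : forall n, exists p : W * set X,
    [/\ C (g n) p.1, S (f p.1) p.2 & p.2 x].
  move=> n; apply: contrapT => np; apply: nN.
  have [[v Cv [Bx _]]|nY] := pselect ((\bigcup_(v in C (g n)) Y v) x);
    last first.
    by left; exists n.
  right; exists n => //; exists v => //; split=> //; split=> // -[E SE Ex].
  by apply: np; exists (v, E).
have hinj : injective (fun n => (h n).2).
  move=> n m hnm; have [Cn Sn _] := hP n; have [Cm Sm _] := hP m.
  apply: ginj; rewrite ?inE//; apply: triC => //.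
  exists (h n).1; split=> //; rewrite (_ : (h n).1 = (h m).1)//.
  by apply: finj; apply: triS => //; exists (h n).2; split=> //; rewrite hnm.
have /infiniteP : [set: nat] #<= [set B | A B /\ B x].
  apply: (card_le_inj (f := fun n => (h n).2)) => [n _|n m _ _ /hinj//].
  by have [_ /SA] := hP n.
by apply; exact: finA.
Qed.

End Splitting.

(** * Quasi-measurable cardinals *)

Lemma quotient_class_eq0 (T : Type) (J : set (set T)) (Z : set T) :
  sigma_ideal J -> quotient_class J Z = quotient_class J set0 <-> J Z.
Proof.
move=> sJ; split=> [e|JZ].
  have : quotient_class J Z set0.
    by rewrite e /quotient_class /= setYK; exact: sigma_ideal_set0.
  by rewrite /quotient_class /= setY0.
apply/seteqP; split=> Z'; rewrite /quotient_class /= set0Y => JZ'.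
  apply: (sigma_ideal_sub sJ _ (sigma_idealU sJ JZ JZ')) => x Zx.
  by have [Z_x|nZ_x] := pselect (Z x); [left|right; right].
apply: (sigma_ideal_sub sJ _ (sigma_idealU sJ JZ JZ')) => x [[]|[]] *.
  by left.
by right.
Qed.

Section Dichotomy.
Context (W : Type) (lt : W -> W -> Prop) (om : omega1_order lt).

(** If [J] has no omega_1 disjoint positive sets and is not trivial on small
    sets, take a shortest sequence of null sets with a non-null union. Subtract
    from each term the earlier ones; the sets of indices of null unions form an
    ideal which is additive because the sequence is shortest, and c.c.c. because
    of the hypothesis on [J]. *)
Lemma split_or_small (T : Type) (J : set (set T)) :
  (forall K : Type, card_lt [set: K] [set: nat -> bool] ->
     ~ quasi_measurable K) ->
  sigma_ideal J -> contains_singletons J ->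
  (exists S : W -> set T, (forall w, ~ J (S w)) /\ trivIset setT S) \/
  (forall S : set T, card_lt S [set: nat -> bool] -> J S).
Proof.
move=> nqm sJ J1; have [|nsplit] := pselect (exists S : W -> set T,
  (forall w, ~ J (S w)) /\ trivIset setT S); [by left|right].
move=> S [Sc cS]; apply: contrapT => nJS.
(* Lengths of families of null sets with a non-null union. *)
pose P (Z : set T) := exists F : T -> set T,
  (forall v, J (F v)) /\ ~ J (\bigcup_(v in Z) F v).
have Pinj (U : Type) (Z : set U) (F : U -> set T) (f : U -> T) :
    set_inj Z f -> (forall u, Z u -> J (F u)) -> ~ J (\bigcup_(u in Z) F u) ->
    P (f @` Z).
  move=> finj JF nJ.
  exists (fun t => \bigcup_(u in [set u | Z u /\ f u = t]) F u).
  split=> [t|JU].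
    apply: sigma_ideal_bigcup => // [|u [/JF]//].
    apply: (card_le_inj (f := fun=> 0%N)) => // u v.
    move=> /set_mem[Zu fu] /set_mem[Zv fv] _.
    by apply: finj; rewrite ?inE// fu.
  apply: nJ; apply: (sigma_ideal_sub sJ _ JU) => x [u Zu Fx].
  by exists (f u); [exists u|exists u].
have Pup (A B : set T) : A #<= B -> P A -> P B.
  move=> AB [F [JF nJ]].
  have [a Aa] : exists a, A a.
    apply: contrapT => nA; apply: nJ.
    apply: (sigma_ideal_sub sJ _ (sigma_ideal_set0 sJ)) => x [a Aa].
    by case: nA; exists a.
  have [f fAB finj] := card_le_injE a AB.
  have [G [JG nG]] := Pinj _ _ F f finj (fun u _ => JF u) nJ.
  exists G; split=> // JB; apply: nG; apply: (sigma_ideal_sub sJ _ JB).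
  by move=> x [_ [u Au <-] Gx]; exists (f u) => //; exact: fAB.
have PS : P S.
  exists set1; split=> [v|JU]; first exact: J1.
  by apply: nJS; apply: (sigma_ideal_sub sJ _ JU) => x Sx; exists x.
have [ltT wo] := exists_strict_wo T; have [_ tr tot] := wo.
(* [E] plays the role of the cardinal [kappa]. *)
have [E [sE [F [JF nJF]] ES _ Emin]] := minimal_segment wo Pup PS.
pose N v := F v `\` \bigcup_(u in [set u | ltT u v]) F u.
have JN v : J (N v) by apply: (sigma_ideal_sub sJ _ (JF v)) => x [].
have triN : trivIset setT N.
  move=> v w _ _ [x [[Fv nv] [Fw nw]]]; have [vw|//|wv] := tot v w.
    by case: nw; exists v.
  by case: nv; exists w.
pose K := {v : T | E v}.
have svalI : injective (sval : K -> T).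
  by move=> [u Eu] [v Ev] /= uv; subst v; congr exist; exact: Prop_irrelevance.
pose U (Z : set K) := \bigcup_(k in Z) N (sval k).
pose J' (Z : set K) := J (U Z).
have sJ' : sigma_ideal J'.
  split; first split.
  - rewrite /J' (_ : U set0 = set0); first exact: sigma_ideal_set0.
    by apply/seteqP; split=> // x [].
  - move=> Z Z' ZZ'; apply: (sigma_ideal_sub sJ) => x [k /ZZ' Zk Nx].
    by exists k.
  - move=> Z Z' JZ JZ'; rewrite /J' /U bigcup_setU; exact: sigma_idealU.
  - move=> Z JZ; rewrite /J'; have [_ sJb] := sJ.
    apply: (sigma_ideal_sub sJ _ (sJb _ JZ)) => x [k [n _ Zk] Nx].
    by exists n => //; exists k.
have nJ'T : ~ J' setT.
  move=> JT; apply: nJF; apply: (sigma_ideal_sub sJ _ JT) => x [v Ev Fx].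
  have [|z [Ez Fz] zmin] := @strict_wo_min _ _ wo [set v | E v /\ F v x].
    by exists v.
  exists (exist _ z Ez) => //; split=> // -[u uz Fu].
  by apply: (zmin u uz); split=> //; exact: sE uz Ez.
have KE : [set: K] #<= E.
  by apply: (card_le_inj (f := sval)) => [[v]//|k k' _ _]; exact: svalI.
have cKc : card_lt [set: K] [set: nat -> bool].
  split; first exact: card_le_trans KE (card_le_trans ES Sc).
  by move=> cK; apply: cS; exact: card_le_trans cK (card_le_trans KE ES).
apply: (nqm K cKc); split.
  by move=> cK; apply: nJ'T; apply: sigma_ideal_bigcup.
exists J'; split.
- by split=> //; have [] := sJ'.
- move=> G GJ' [GK nKG]; apply: contrapT => nJG.
  have [t0 _] : exists t : T, True.
    apply: contrapT => nT; apply: nJS.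
    apply: (sigma_ideal_sub sJ _ (sigma_ideal_set0 sJ)) => x _.
    by apply: nT; exists x.
  have [j jE jinj] := card_le_injE t0 (card_le_trans GK KE).
  have PjG : P (j @` G).
    apply: (Pinj _ _ U j jinj) => [Z /GJ'//|JU].
    apply: nJG; apply: (sigma_ideal_sub sJ _ JU) => x [k [Z GZ Zk] Nx].
    by exists Z => //; exists k.
  have EG : E #<= j @` G.
    apply: Emin => //; apply: subset_card_le => _ [Z GZ <-]; exact: jE.
  apply: nKG; apply: (card_le_trans KE); apply: (card_le_trans EG).
  exact: card_image_le.
- move=> k; apply: (sigma_ideal_sub sJ _ (JN (sval k))) => x [k' ->//].
- move=> G Grange G0 Gmeet; apply: contrapT => ncG.
  have [f fG finj] := omega1_inj om ncG.
  have /choice[Z ZP] : forall w, exists Z, quotient_class J' Z = f w.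
    by move=> w; have [Z _ <-] := Grange _ (fG w); exists Z.
  have [|v w vw|nZ triZ] := omega1_disjointify om (Z := Z) sJ'.
  + move=> w /(quotient_class_eq0 _ sJ'); rewrite ZP => fw0.
    by apply: G0; rewrite -fw0.
  + apply/(quotient_class_eq0 _ sJ'); apply: Gmeet; rewrite ?ZP//.
    by move=> /finj.
  apply: nsplit.
  exists (fun w => U (Z w `\` \bigcup_(v in [set v | lt v w]) Z v)); split=> //.
  move=> v w _ _ [x [[k Zk Nk] [k' Zk' Nk']]].
  have kk' : k = k' by apply/svalI/triN => //; exists x.
  by apply: triZ => //; exists k; split=> //; rewrite kk'.
Qed.

End Dichotomy.

(** * Splitting below a positive Borel set *)

Lemma cantor_uncountable : ~ countable [set: nat -> bool].
Proof.
move=> /countable_injP[f finj].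
pose d n := ~~ `[< exists2 a, f a = n & a n >].
have := erefl (d (f d)); rewrite {1}/d; case: asboolP => [[a fa]|nd] /=.
  by rewrite (finj a d) ?inE// => dfd; rewrite dfd.
by move=> dfd; case: nd; exists d.
Qed.

Section LocalSplitting.
Context (X : topologicalType) (I : set (set X)) (A : set (set X)).
Context (W : Type) (lt : W -> W -> Prop) (om : omega1_order lt).
Context (sI : sigma_ideal I) (bI : has_Borel_base I).
Context (E : (nat -> bool) -> set X) (BorelE : @Borel X `<=` range E).

Local Notation D := (\bigcup_(B in A) B).

(** Bernstein's construction: a member of [A] is chosen for each pair of a
    positive Borel subset of [B] and an index, distinct from the fewer than
    continuum many members that were chosen before. *)
Lemma bernstein_splits (B : set X) :
  (forall S : set (set X), card_lt S [set: nat -> bool] ->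
     I (B `&` \bigcup_(C in S `&` A) C)) ->
  splits I A W A B.
Proof.
move=> smallI.
have [ltK wo] := exists_strict_wo (nat -> bool).
(* [G] indexes the stages: it has the size of the continuum, while its proper
   initial segments are smaller. *)
have [//|G [sG TG _ Gv _]] := @minimal_segment _ _ wo
  (fun Z => [set: nat -> bool] #<= Z) setT
  (fun A B AB TA => card_le_trans TA AB) _.
have [j jG jinj] := card_le_injE (fun=> true) TG.
have /choice[s sP] : forall w, exists k, forall k', j k' = w -> k' = k.
  move=> w; have [[k <-]|nk] := pselect (exists k, j k = w).
    by exists k => k' jk; apply: jinj; rewrite ?inE.
  by exists w => k jk; case: nk; exists k.
have [e _ einj] := omega1_inj om cantor_uncountable.
(* The point [s w] of the Cantor space codes a Borel set in its even entries
   and an element of [W] in its odd entries. *)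
pose BE w := E (fun n => s w n.*2).
pose valid w := [/\ G w, positive I D (BE w) & BE w `<=` B].
have [|h [hP hdisj]] := @transfinite_choice _ _ wo _ set0
    (fun w C => valid w -> A C /\ C `&` BE w !=set0)
    (fun v w C C' => valid v -> valid w -> C <> C').
  move=> w h; have [vw|nvw] := pselect (valid w); last by exists set0.
  have [Gw [_ nBE] BEB] := vw.
  have /smallI IS : card_lt (h @` [set v | ltK v w]) [set: nat -> bool].
    split.
      apply: card_le_trans (card_image_le _ _) _.
      exact: card_leT.
    move=> cS; apply: (Gv w Gw); apply: card_le_trans cS _.
    exact: card_image_le.
  have [C AC [x [Cx BEx nC]]] : exists2 C, A C & exists x, [/\ C x, BE w x &
      ~ (h @` [set v | ltK v w]) C].
    apply: contrapT => nC; apply: nBE; apply: (sigma_ideal_sub sI _ IS).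
    move=> x [BEx [C AC Cx]]; split; first exact: BEB.
    exists C => //; split=> //; apply: contrapT => nhC; apply: nC.
    by exists C => //; exists x.
  exists C; split=> [_|v vltw _ _ hv]; first by split=> //; exists x.
  by apply: nC; exists v.
have [_ _ tot] := wo.
have hinj v w : valid v -> valid w -> h v = h w -> v = w.
  move=> vv vw hvw; have [lvw|//|lwv] := tot v w.
    by have := hdisj _ _ lvw vv vw.
  by have := hdisj _ _ lwv vw vv; rewrite hvw.
exists (fun xi => [set h w | w in [set w | valid w /\
  (fun n => s w n.*2.+1) = e xi]]); split.
- by move=> xi _ [w [vw _] <-]; have [] := hP w vw.
- move=> xi xi' _ _ [_ [[w [vw ew] <-] [w' [vw' ew'] hw]]].
  by apply: einj; rewrite -ew -ew' (hinj _ _ vw' vw hw).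
move=> B' [bB' nB'] B'B cB'.
have [_ ncW _] := om.
have [xi _ /contrapT Ixi] := countable_uncountable_ex cB' ncW.
(* The null trace is removed from [B'] by a Borel null set, but the member of
   [A] chosen for the difference meets it in a point of that trace. *)
have [N [IN bN IxiN]] := bI Ixi.
have [k0 _ Ek0] := BorelE (Borel_setD bB' bN).
pose k n := if odd n then e xi n./2 else k0 n./2.
have sjk : s (j k) = k by apply/esym/sP.
have BEjk : BE (j k) = B' `\` N.
  rewrite /BE sjk -Ek0; congr E; apply/funext => n.
  by rewrite /k odd_double doubleK.
have vjk : valid (j k).
  split; first exact: jG.
  - rewrite BEjk; split; first exact: Borel_setD.
    move=> IB'; apply: nB'.
    apply: (sigma_ideal_sub sI _ (sigma_idealU sI IN IB')) => x [Bx Dx].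
    by have [Nx|nNx] := pselect (N x); [left|right].
  - by rewrite BEjk => x [/B'B].
have [Ah [x [hx]]] := hP _ vjk; rewrite BEjk => -[B'x nNx].
apply: nNx; apply: IxiN; split=> //; exists (h (j k)) => //.
exists (j k) => //; split=> //; rewrite sjk; apply/funext => n.
by rewrite /k /= odd_double uphalf_double.
Qed.

Context (cI : ccc_ideal I).

Lemma splits_below (B : set X) :
  (forall K : Type, card_lt [set: K] [set: nat -> bool] ->
     ~ quasi_measurable K) ->
  A `<=` I -> positive I D B ->
  exists H, [/\ positive I D H, H `<=` B & splits I A W A H].
Proof.
move=> nqm AI pB; have [bB nB] := pB.
pose J (S : set (set X)) := I (B `&` \bigcup_(C in S `&` A) C).
have sJ : sigma_ideal J.
  split; first split.
  - apply: (sigma_ideal_sub sI _ (sigma_ideal_set0 sI)) => x [_ [C []]] //.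
  - move=> S S' SS'; apply: (sigma_ideal_sub sI); apply: setIS.
    by move=> x [C [/SS' SC AC] Cx]; exists C.
  - move=> S S' JS JS'; rewrite /J setIUl bigcup_setU setIUr.
    exact: sigma_idealU.
  - move=> S JS; have [_ sIb] := sI.
    apply: (sigma_ideal_sub sI _ (sIb _ JS)) => x [Bx [C [[n _ SC] AC] Cx]].
    by exists n => //; split=> //; exists C.
have J1 : contains_singletons J.
  move=> C; rewrite /J; have [AC|nAC] := pselect (A C).
    apply: (sigma_ideal_sub sI _ (AI _ AC)) => x [_ [C' [-> _]]] //.
  apply: (sigma_ideal_sub sI _ (sigma_ideal_set0 sI)) => x [_ [C' [-> AC]]] //.
have [[S [nS triS]]|small] := split_or_small om nqm sJ J1; last first.
  by exists B; split=> //; apply: bernstein_splits.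
pose Y w := \bigcup_(C in S w `&` A) C.
have YD w : Y w `<=` D by move=> x [C [_ AC] Cx]; exists C.
have [H [pH HB cpH]] := cofinally_positive_part sI cI om YD bB nS.
exists H; split=> //; exists (fun w => S w `&` A); split.
- by move=> w; exact: subIsetr.
- by move=> v w _ _ [C [[SC _] [SC' _]]]; apply: triS => //; exists C.
- exact: cpH.
Qed.

(** By [splits_below], the Borel sets that are split by [A] exhaust all positive
    sets; countably many of them suffice, and their union is split as well. *)
Lemma splits_setT :
  (forall K : Type, card_lt [set: K] [set: nat -> bool] ->
     ~ quasi_measurable K) ->
  A `<=` I -> splits I A W A setT.
Proof.
move=> nqm AI.
have [|H [HP Hmax]] := ccc_exhaustion D sI cI
  (P := [set H | Borel H /\ splits I A W A H]); first by move=> ? [].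
have bH n : Borel (H n) by have [[]//|->] := HP n; exact: Borel_set0.
have sH n : splits I A W A (H n).
  have [[]//|->] := HP n; exists (fun=> set0); split.
  - by move=> w; exact: sub0set.
  - by move=> v w _ _ [x []].
  - move=> B [_ nB] B0; case: nB.
    by apply: (sigma_ideal_sub sI _ (sigma_ideal_set0 sI)) => x [/B0].
have [S [SA triS cpS]] := splits_bigcup om sI cI (@subset_refl _ A) bH sH.
have IC : I (~` (\bigcup_n H n) `&` D).
  apply: contrapT => nC.
  have [|H' [pH' H'C sH']] := @splits_below (~` \bigcup_n H n) nqm AI.
    by split=> //; apply: Borel_setC; exact: Borel_bigcup.
  have [bH' nH'] := pH'; apply: nH'; apply: Hmax => // n.
  by apply/seteqP; split=> // x [/H'C nH Hx]; apply: nH; exists n.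
exists S; split=> // B [bB nB] _ cB.
apply: (cpS (B `&` \bigcup_n H n)) => [| |].
- split; first by apply: Borel_setI => //; exact: Borel_bigcup.
  move=> IB; apply: nB; apply: (sigma_ideal_sub sI _ (sigma_idealU sI IC IB)).
  move=> x [Bx Dx]; have [Hx|nHx] := pselect ((\bigcup_n H n) x).
    by right.
  by left.
- by move=> x [].
apply: sub_countable cB; apply: subset_card_le => w nI IB; apply: nI.
by apply: (sigma_ideal_sub sI _ IB); apply: setSI => x [].
Qed.

End LocalSplitting.

(** * Completely nonmeasurable unions *)

Theorem theorem2p3 (R : realType) (X : topologicalType)
    (I : set (set X)) (A : set (set X))
    (Omega1 : Type) (le1 : rel Omega1) :
  (forall K : Type, card_lt [set: K] [set: nat -> bool] ->
     ~ quasi_measurable K) ->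
  polish_space R X ->
  ~ countable [set: X] ->
  sigma_ideal I ->
  has_Borel_base I ->
  contains_singletons I ->
  ccc_ideal I ->
  A `<=` I ->
  ~ I (\bigcup_(B in A) B) ->
  (forall x : X, finite_set [set B | A B /\ B x]) ->
  is_omega1 le1 ->
  exists A_ : Omega1 -> set (set X),
    [/\ forall xi, A_ xi `<=` A,
        trivIset [set: Omega1] A_
      & forall xi, completely_nonmeasurable I
          (\bigcup_(B in A_ xi) B) (\bigcup_(B in A) B)].
Proof.
move=> nqm polX _ sI bI _ cI AI _ finA /omega1_order_of om.
have [E BorelE] := borel_enumeration polX.
have sT := splits_setT om sI bI BorelE cI nqm AI.
have [S [SA triS fS]] := splits_full om sI cI (@subset_refl _ A) sT.
have cbad := full_almost_all_nonmeasurable om sI cI finA SA triS fS.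
have [f fgood finj] : exists2 f : Omega1 -> Omega1,
    forall xi, completely_nonmeasurable I
      (\bigcup_(B in S (f xi)) B) (\bigcup_(B in A) B) & injective f.
  have [|f fgood finj] := omega1_inj om (S := ~` [set xi | ~
      completely_nonmeasurable I (\bigcup_(B in S xi) B) (\bigcup_(B in A) B)]).
    move=> cgood; have [_ ncW _] := om; apply: ncW.
    by rewrite -(setUv [set xi | ~ completely_nonmeasurable I
      (\bigcup_(B in S xi) B) (\bigcup_(B in A) B)]); exact: countable_setU.
  by exists f => // xi; apply: contrapT; exact: fgood.
exists (fun xi => S (f xi)); split=> // xi zeta _ _ ne.
by apply/finj/triS.
Qed.
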